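(* Let $\mathbb{B}$ be a complete Boolean algebra satisfying condition $(\hbar)$: for every $x\in\mathbb{B}^\omega$ there is $y\prec x$ such that for every $z\prec y$ we have $\limsup z=\limsup y$. Then $\lambda_{\mathrm{ls}}$ and $\lambda_{\mathrm{li}}$ are weakly topological convergences on $\mathbb{B}$.
   Context: For sequences $x,y$, $y\prec x$ means that $y$ is a subsequence of $x$, i.e. $y=x\circ f$ for some strictly increasing $f:\omega\to\omega$; $\omega^{\uparrow\omega}$ is the set of all strictly increasing functions $\omega\to\omega$. A convergence on a nonempty set $X$ is a map $\lambda:X^\omega\to P(X)$. For a topology $\mathcal{O}$ on $X$, $\lim_{\mathcal{O}}(x)$ is the set of all $a\in X$ such that every $\mathcal{O}$-neighborhood of $a$ contains all but finitely many members of $x$; $\lambda$ is topological iff $\lambda=\lim_{\mathcal{O}}$ for some topology $\mathcal{O}$ on $X$. Conditions: (L1) $a\in\lambda(\langle a,a,\dots\rangle)$ for all $a\in X$; (L2) $\lambda(x)\subset\lambda(y)$ for all $x\in X^\omega$ and $y\prec x$; (L3) for all $x\in X^\omega$ and $a\in X$, if for every $y\prec x$ there is $z\prec y$ with $a\in\lambda(z)$, then $a\in\lambda(x)$. For $\lambda$ satisfying (L1) and (L2), put $\lambda^*(y)=\bigcap_{f\in\omega^{\uparrow\omega}}\bigcup_{g\in\omega^{\uparrow\omega}}\lambda(y\circ f\circ g)$; it is the minimal convergence bigger than $\lambda$ satisfying (L1)–(L3). $\lambda$ is weakly topological iff it satisfies (L1) and (L2) and $\lambda^*$ is topological. For a sequence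 $x$ in a complete Boolean algebra $\mathbb{B}$, $\liminf x=\bigvee_{k\in\omega}\bigwedge_{n\ge k}x_n$, $\limsup x=\bigwedge_{k\in\omega}\bigvee_{n\ge k}x_n$, $\lambda_{\mathrm{ls}}(x)=\{b\in\mathbb{B}:b\ge\limsup x\}$ and $\lambda_{\mathrm{li}}(x)=\{b\in\mathbb{B}:b\le\liminf x\}$. *)

(* Defs.v *)
From mathcomp Require Import all_boot all_order.
From mathcomp Require Import all_classical topology.

Set Implicit Arguments.
Unset Strict Implicit.
Unset Printing Implicit Defensive.

Import Order.TTheory.
Local Open Scope classical_set_scope.

Definition strictly_increasing : set (nat -> nat) :=
  [set f | {homo f : m n / (m < n)%N}].

Definition subsequence (X : Type) (y x : nat -> X) : Prop :=
  exists2 f, strictly_increasing f & y = x \o f.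

Definition convergence (X : Type) : Type := (nat -> X) -> set X.

(* The topology [O] is a variable, hence the explicit [Topological.Pack]. *)
Definition topology_lim (X : Type) (O : Topological X) : convergence X :=
  fun x => [set a : Topological.Pack O |
             (x : nat -> Topological.Pack O) @ \oo --> a].

Definition topological (X : Type) (lambda : convergence X) : Prop :=
  exists O : Topological X, lambda = topology_lim O.

Definition L1 (X : Type) (lambda : convergence X) : Prop :=
  forall a : X, lambda (fun=> a) a.

Definition L2 (X : Type) (lambda : convergence X) : Prop :=
  forall x y : nat -> X, subsequence y x -> lambda x `<=` lambda y.

Definition star (X : Type) (lambda : convergence X) : convergence X :=
  fun y => \bigcap_(f in strictly_increasing)
             \bigcup_(g in strictly_increasing) lambda (y \o f \o g).

Definition weakly_topological (X : Type) (lambda : convergence X) : Prop :=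
  [/\ L1 lambda, L2 lambda & topological (star lambda)].

Definition complete_lattice (d : Order.disp_t) (B : latticeType d) : Prop :=
  forall A : set B, supremums A !=set0 /\ infimums A !=set0.

Section BooleanAlgebra.
Context (d : Order.disp_t) (B : ctbDistrLatticeType d).
Implicit Types (x y z : nat -> B) (A : set B).

(* The default value is the one taken on the empty set, so that these are the
   arbitrary join and meet whenever [B] is complete. *)
Definition bigjoin A : B := supremum \bot%O A.
Definition bigmeet A : B := infimum \top%O A.

Definition liminf x : B :=
  bigjoin (range (fun k => bigmeet [set x n | n in [set n | (k <= n)%N]])).
Definition limsup x : B :=
  bigmeet (range (fun k => bigjoin [set x n | n in [set n | (k <= n)%N]])).

Definition lambda_ls : convergence B :=
  fun x => [set b | (limsup x <= b)%O].
Definition lambda_li : convergence B :=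
  fun x => [set b | (b <= liminf x)%O].

Definition hbar : Prop :=
  forall x, exists2 y, subsequence y x &
    forall z, subsequence z y -> limsup z = limsup y.

End BooleanAlgebra.

Arguments lambda_ls {d} B.
Arguments lambda_li {d} B.
Arguments hbar {d} B.

(* Main.v *)
Require Import Defs.
From HB Require Import structures.
From mathcomp Require Import all_boot all_order.
From mathcomp Require Import all_classical topology.

Set Implicit Arguments.
Unset Strict Implicit.
Unset Printing Implicit Defensive.

Import Order.Theory.
Local Open Scope classical_set_scope.

(** The topology witnessing weak topologicality of a convergence [lambda] is
    the sequential one: [U] is open when every sequence with a
    [lambda]-limit in [U] is eventually in [U].  Convergence in the sense of
    [star lambda] always implies convergence in this topology
    ([star_sub_sequential_lim]).  For the converse one must show that if [a] is
    in no [lambda]-limit of a subsequence of some [y], then [y] fails to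
    converge to [a] topologically; it suffices to find a sequentially closed
    set avoiding [a] and containing almost all members of a subsequence of [y]
    ([weakly_topological_by_separation]).

    Condition [hbar] provides such a set for [lambda_ls].  Pass to a
    subsequence [z] all of whose subsequences have the same upper limit [c],
    and let [F] be the upward closure of [c] and of the [z n] with [n >= m].
    Consider a sequence [w] in [F].  Either a single generator of [F] is
    infinitely often below the members of [w], and then it is below
    [limsup w]; or infinitely many different [z n] are used, and then a
    subsequence of [z] is pointwise below a subsequence of [w], so that
    [c <= limsup w].  In both cases [limsup w] is in [F], hence [F] is
    sequentially closed ([tail_cone_closed]).  If [c <= a] fails, then
    [z n <= a] holds for finitely many [n] only, as otherwise a subsequence of
    [z] would have an upper limit below [a]; so [F] avoids [a] for [m] large.

    This uses only that [limsup] fixes constants, is monotone and decreases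
    along subsequences, in a partial order.  The same theorem therefore applies
    to [liminf] on the dual order, where the three properties and the analogue
    of [hbar] come from [liminf x = ~` limsup (~` x)]. *)

(** * Strictly increasing maps and subsequences *)

Lemma strictly_increasing_id : strictly_increasing id.
Proof. by []. Qed.

Lemma strictly_increasing_comp f g :
  strictly_increasing f -> strictly_increasing g -> strictly_increasing (f \o g).
Proof. by move=> sf sg m n /sg/sf. Qed.

Lemma strictly_increasing_ge f n : strictly_increasing f -> (n <= f n)%N.
Proof. by move=> sf; elim: n => // n IHn; exact: leq_ltn_trans IHn (sf _ _ _). Qed.

Lemma near_subsequence (P : set nat) f : strictly_increasing f ->
  (\forall n \near \oo, P n) -> \forall n \near \oo, P (f n).
Proof.
move=> sf [N _ PN]; exists N => // n /= Nn; apply: PN => /=.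
exact: leq_trans Nn (strictly_increasing_ge _ sf).
Qed.

(** Extracts two subsequences at once: this is what turns infinitely many
    comparisons [z n <= w k] into a pointwise comparison of a subsequence of
    [z] with a subsequence of [w]. *)
Lemma cofinal_pairs (P : nat -> nat -> Prop) :
  (forall N, exists kn, [/\ (N <= kn.1)%N, (N <= kn.2)%N & P kn.1 kn.2]) ->
  exists f g, [/\ strictly_increasing f, strictly_increasing g &
                  forall i, P (f i) (g i)].
Proof.
move=> /choice[h hP].
(* Each new pair is taken beyond both components of the previous one. *)
pose s := fix s i := if i is i'.+1 then h (maxn (s i').1 (s i').2).+1 else h 0%N.
have step i : ((s i).1 < (s i.+1).1)%N /\ ((s i).2 < (s i.+1).2)%N.
  have [h1 h2 _] := hP (maxn (s i).1 (s i).2).+1.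
  split; first exact: leq_trans (leq_ltn_trans (leq_maxl _ _) (ltnSn _)) h1.
  exact: leq_trans (leq_ltn_trans (leq_maxr _ _) (ltnSn _)) h2.
exists (fst \o s), (snd \o s); split.
- by apply: homo_ltn => [|i]; [exact: ltn_trans | have [] := step i].
- by apply: homo_ltn => [|i]; [exact: ltn_trans | have [] := step i].
- by case=> [|i] /=; [have [] := hP 0%N | have [] := hP (maxn (s i).1 (s i).2).+1].
Qed.

Lemma not_near_subsequence (P : set nat) : ~ (\forall n \near \oo, P n) ->
  exists2 f, strictly_increasing f & forall i, ~ P (f i).
Proof.
move=> nP; have [N|f [g [sf _ nPf]]] := @cofinal_pairs (fun k _ => ~ P k).
  apply: contrapT => noN; apply: nP; exists N => // k /= Nk.
  by apply: contrapT => nPk; apply: noN; exists (k, N); split.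
by exists f.
Qed.

(** * The sequential topology of a convergence *)

(** A type synonym, so that each convergence on [X] comes with a topology of
    its own. *)
Definition sequential_space (X : choiceType) (lambda : convergence X) : Type := X.

Section SequentialTopology.
Context (X : choiceType) (lambda : convergence X).

HB.instance Definition _ := Choice.on (sequential_space lambda).

Definition sequentially_open (U : set X) : Prop :=
  forall x a, U a -> lambda x a -> \forall n \near \oo, U (x n).

Definition sequentially_closed (F : set X) : Prop :=
  forall x a, (forall n, F (x n)) -> lambda x a -> F a.

Let openT : sequentially_open setT.
Proof. by move=> x a _ _; exact: filterT. Qed.

Let openI : setI_closed sequentially_open.
Proof.
by move=> U V oU oV x a [Ua Va] xa; apply: filterI; [exact: oU Ua xa|exact: oV Va xa].
Qed.

Let open_bigcup (I : Type) (U : I -> set X) :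
  (forall i, sequentially_open (U i)) -> sequentially_open (\bigcup_i U i).
Proof.
move=> oU x a [i _ Uia] xa.
by apply: filterS (oU i x a Uia xa) => n Uin; exists i.
Qed.

HB.instance Definition _ := isOpenTopological.Build (sequential_space lambda)
  openT openI open_bigcup.

Definition sequential_topology : Topological X :=
  Topological.class (sequential_space lambda).

Lemma sequential_limP x a : topology_lim sequential_topology x a <->
  forall U, sequentially_open U -> U a -> \forall n \near \oo, U (x n).
Proof.
split=> [xa U oU Ua|xa A].
  by apply: xa; exists U; split.
by move=> [U [oU Ua UA]]; apply: filterS (xa U oU Ua) => n /UA.
Qed.

(** By (L2), a sequence that returns infinitely often to [F] can be replaced by
    one that lies in [F] and has the same limit. *)
Lemma sequentially_closedC (F : set X) : L2 lambda ->
  sequentially_closed F -> sequentially_open (~` F).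
Proof.
move=> lambda2 cF x a nFa xa; apply: contrapT => /not_near_subsequence[f sf Ff].
apply: nFa; apply: (cF (x \o f)) => [n|]; first exact: contrapT (Ff n).
by apply: lambda2 xa; exists f.
Qed.

(** A subsequence avoiding an open neighbourhood of [a] would itself have a
    subsequence with [lambda]-limit [a], which must enter that neighbourhood. *)
Lemma star_sub_sequential_lim x :
  star lambda x `<=` topology_lim sequential_topology x.
Proof.
move=> a xa; apply/sequential_limP => U oU Ua; apply: contrapT.
move=> /not_near_subsequence[f sf nUf]; have [g sg fga] := xa f sf.
by have [N _ /(_ N (leqnn N))] := oU _ _ Ua fga; exact: nUf.
Qed.

(** Only one subsequence [y] of each [x] has to be separated from the points
    outside [lambda y], because [star lambda] asks only for some further
    subsequence; this leaves room to choose a [y] with good stability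
    properties. *)
Lemma weakly_topological_by_separation :
  L1 lambda -> L2 lambda ->
  (forall x, exists2 y, subsequence y x & forall a, ~ lambda y a ->
     exists F, [/\ sequentially_closed F, ~ F a & \forall n \near \oo, F (y n)]) ->
  weakly_topological lambda.
Proof.
move=> lambda1 lambda2 sep; split=> //; exists sequential_topology.
apply/funext => x; rewrite eqEsubset; split; first exact: star_sub_sequential_lim.
move=> a /sequential_limP xa f sf.
have [y [g sg ->] {}sep] := sep (x \o f); exists g => //.
apply: contrapT => /sep[F [cF nFa Fy]].
have /(near_subsequence (strictly_increasing_comp sf sg)) nFx :=
  xa _ (sequentially_closedC lambda2 cF) nFa.
by have [n [Fn]] := filter_ex (filterI Fy nFx).
Qed.

End SequentialTopology.

(** * Upper limits in a partial order *)

Section UpperLimit.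
Context (d : Order.disp_t) (P : porderType d) (L : (nat -> P) -> P).
Hypothesis L_const : forall a, L (fun=> a) = a.
Hypothesis L_le : forall x y f, strictly_increasing f ->
  (forall i, x i <= y (f i))%O -> (L x <= L y)%O.

Let upper : convergence P := fun x => [set b | (L x <= b)%O].

Let upper2 : L2 upper.
Proof.
move=> x _ [f sf ->] b /=; apply: le_trans.
exact: L_le sf _.
Qed.

Let le_upper_limit w f a : strictly_increasing f ->
  (forall i, a <= w (f i))%O -> (a <= L w)%O.
Proof. by move=> sf aw; rewrite -(L_const a); exact: L_le sf aw. Qed.

(** The upward closure of [L z] and of the [z n] with [m <= n].  When all
    subsequences of [z] have the same upper limit, it is the smallest
    sequentially closed set containing this tail of [z]. *)
Definition tail_cone (z : nat -> P) (m : nat) : set P :=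
  [set b | (L z <= b)%O \/ exists2 n, (m <= n)%N & (z n <= b)%O].

(** The upper limit of a sequence [w] in the cone lies in the cone: either some
    generator is below [w] infinitely often, or [w] uses infinitely many of
    the [z n] and so dominates a subsequence of [z], whose upper limit is
    again [L z]. *)
Lemma tail_cone_closed z m :
  (forall y, subsequence y z -> L y = L z) ->
  sequentially_closed upper (tail_cone z m).
Proof.
move=> z_stable w b Fw /= wb.
suff [Lw|[n mn Lw]] : tail_cone z m (L w).
- by left; exact: le_trans wb.
- by right; exists n => //; exact: le_trans wb.
(* First the two cases where one generator, [L z] or a fixed [z n], is below
   [w] infinitely often. *)
have [nc|/not_near_subsequence[f sf cw]] :=
    pselect (\forall k \near \oo, ~ (L z <= w k)%O); last first.
  by left; apply: le_upper_limit sf _ => i; exact: contrapT (cw i).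
have [nz|/existsNP[n /not_implyP[mn /not_near_subsequence[f sf zw]]]] :=
    pselect (forall n, (m <= n)%N -> \forall k \near \oo, ~ (z n <= w k)%O); last first.
  by right; exists n => //; apply: le_upper_limit sf _ => i; exact: contrapT (zw i).
(* Otherwise each generator is eventually not below [w], so the late members of
   [w] are above some [z n] with [n] arbitrarily large. *)
have [N|f [g [sf sg zw]]] := @cofinal_pairs (fun k n => (z n <= w k)%O).
  have nzN : \forall k \near \oo,
      forall n, (m <= n < N)%N -> ~ (z n <= w k)%O.
    elim: N => [|N IHN]; first by apply: nearW => k n; rewrite ltn0 andbF.
    have [mN|Nm] := leqP m N; last first.
      apply: nearW => k n /andP[mn nN].
      by have := leq_trans mn (ltnSE nN); rewrite leqNgt Nm.
    apply: filterS2 IHN (nz N mN) => k IHk nzk n /andP[mn].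
    by rewrite ltnS leq_eqVlt => /predU1P[->//|nN]; apply: IHk; rewrite mn.
  have [k [[nck nzk] Nk]] := filter_ex (filterI (filterI nc nzN) (nbhs_infty_ge N)).
  have [//|[n mn znk]] := Fw k.
  exists (k, n); split=> //=; rewrite leqNgt; apply/negP => nN.
  by apply: nzk znk; rewrite mn.
left; rewrite -(z_stable (z \o g)); last by exists g.
exact: L_le sf zw.
Qed.

(** If [L z <= a] fails for a stable [z], then [z n <= a] holds for finitely
    many [n] only, so that a tail cone of [z] avoids [a]. *)
Lemma weakly_topological_upper :
  (forall x, exists2 y, subsequence y x &
     forall z, subsequence z y -> L z = L y) ->
  weakly_topological upper.
Proof.
move=> L_stable; apply: weakly_topological_by_separation upper2 _.
  by move=> a; rewrite /upper /= L_const.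
move=> x; have [z zx z_stable] := L_stable x; exists z => // a nza.
have [m am] : exists m, forall n, (m <= n)%N -> ~ (z n <= a)%O.
  apply: contrapT => nom; apply: nza.
  have [[m _ am]|f sf za] :=
      @not_near_subsequence (fun n => ~ (z n <= a)%O).
    by apply: nom; exists m.
  rewrite /upper /= -(z_stable (z \o f)); last by exists f.
  rewrite -(L_const a); apply: L_le strictly_increasing_id _ => i.
  exact: contrapT (za i).
exists (tail_cone z m); split; first exact: tail_cone_closed.
- by case=> [//|[n /am]].
- by exists m => // n mn; right; exists n.
Qed.

End UpperLimit.

(** * Upper and lower limits in a complete Boolean algebra *)

Section BooleanLimits.
Context (d : Order.disp_t) (B : ctbDistrLatticeType d).
Hypothesis B_complete : complete_lattice B.
Implicit Types (x y : nat -> B) (A : set B).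

(** Holds for empty [A] too, since the default value of [bigjoin] is the least
    element. *)
Lemma bigjoin_leP A b : (bigjoin A <= b)%O <-> ubound A b.
Proof.
have [[s sA] _] := B_complete A; rewrite /bigjoin /supremum.
case: ifPn => [/eqP ->|_]; first by split=> [_ a []|_]; exact: le0x.
have [ubA lubA] : supremums A (xget \bot%O (supremums A)) by by apply: xgetPex; exists s.
by split=> [Ab a /ubA aA|/lubA//]; exact: le_trans Ab.
Qed.

Lemma le_bigmeetP A b : (b <= bigmeet A)%O <-> lbound A b.
Proof.
have [_ [s sA]] := B_complete A; rewrite /bigmeet /infimum.
case: ifPn => [/eqP ->|_]; first by split=> [_ a []|_]; exact: lex1.
have [lbA glbA] : infimums A (xget \top%O (infimums A)) by by apply: xgetPex; exists s.
by split=> [bA a /lbA|/glbA//]; exact: le_trans bA.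
Qed.

Lemma bigjoin_ub A a : A a -> (a <= bigjoin A)%O.
Proof. by apply: (bigjoin_leP A _).1. Qed.

Lemma bigmeet_lb A a : A a -> (bigmeet A <= a)%O.
Proof. by apply: (le_bigmeetP A _).1. Qed.

Lemma bigjoin_compl A : bigjoin (Order.compl @` A) = Order.compl (bigmeet A).
Proof.
apply/eqP; rewrite eq_le; apply/andP; split.
  by apply/bigjoin_leP => _ [a Aa <-]; rewrite leC; exact: bigmeet_lb.
rewrite leCx; apply/le_bigmeetP => a Aa.
by rewrite leCx; apply: bigjoin_ub; exists a.
Qed.

Lemma bigmeet_compl A : bigmeet (Order.compl @` A) = Order.compl (bigjoin A).
Proof.
rewrite -[LHS]complK -bigjoin_compl image_comp; congr (Order.compl (bigjoin _)).
by under eq_imagel do rewrite /= complK; rewrite image_id.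
Qed.

Lemma limsup_compl x : limsup (Order.compl \o x) = Order.compl (liminf x).
Proof.
rewrite /limsup /liminf -bigmeet_compl image_comp; congr bigmeet.
by apply: eq_imagel => k _; rewrite /= -bigjoin_compl image_comp.
Qed.

Lemma limsup_const (a : B) : limsup (fun=> a) = a.
Proof.
apply/eqP; rewrite eq_le; apply/andP; split.
  apply: le_trans (bigmeet_lb _) _; first by exists 0%N.
  by apply/bigjoin_leP => _ [n _ <-].
apply/le_bigmeetP => _ [k _ <-]; apply: bigjoin_ub.
by exists k => //=; exact: leqnn.
Qed.

Lemma limsup_le x y f : strictly_increasing f ->
  (forall i, x i <= y (f i))%O -> (limsup x <= limsup y)%O.
Proof.
move=> sf xy; apply/le_bigmeetP => _ [k _ <-].
apply: le_trans (bigmeet_lb _) _; first by exists k.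
apply/bigjoin_leP => _ [n /= kn <-]; apply: le_trans (xy n) (bigjoin_ub _).
by exists (f n) => //=; exact: leq_trans kn (strictly_increasing_ge _ sf).
Qed.

End BooleanLimits.

Theorem theorem6p1 (d : Order.disp_t) (B : ctbDistrLatticeType d)
    (B_complete : complete_lattice B) (B_hbar : hbar B) :
  weakly_topological (lambda_ls B) /\ weakly_topological (lambda_li B).
Proof.
split.
  apply: weakly_topological_upper B_hbar.
  - exact: limsup_const.
  - exact: limsup_le.
have liminfE (x : nat -> B) : liminf x = Order.compl (limsup (Order.compl \o x)).
  by rewrite limsup_compl ?complK.
(* In the dual order the lower limit is an upper limit. *)
apply: (@weakly_topological_upper _ B^d (@liminf _ B)).
- move=> a; rewrite liminfE; have := limsup_const B_complete (Order.compl a).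
  by rewrite /comp => ->; rewrite complK.
- move=> x y f sf yx; rewrite leEdual !liminfE leC.
  apply: limsup_le sf _ => // i /=; rewrite leC; exact: yx.
(* A stable subsequence of the complements of [x] gives one of [x]. *)
- move=> x; have [y [f sf yE] y_stable] := B_hbar (Order.compl \o x).
  have xf : Order.compl \o (x \o f) = y by rewrite yE.
  exists (x \o f); first by exists f.
  move=> _ [g sg ->]; rewrite !liminfE xf; congr Order.compl.
  by apply: y_stable; exists g => //; rewrite -xf.
Qed.
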